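(* Let $\lambda$ be a nonzero complex number. For every integer $n\geq 0$, $$\frac{C_{n+1,\lambda}^*(1)-C_{n+1,\lambda}^*}{n+1} = \sum_{l=0}^n \binom{n}{l} C_{l,\lambda}\, \lambda^{n-l} D_{n-l}^{(2)},$$ where $C_{n,\lambda}^*(x)$ are the degenerate Cauchy polynomials, $C_{n,\lambda}^*=C_{n,\lambda}^*(0)$, $C_{l,\lambda}$ are the degenerate Cauchy numbers of the second kind, and $D_n^{(2)}$ are the Daehee numbers of order $2$.
   Context: All generating functions are formal power series in $t$; $\log(1+u)=\sum_{k\ge 1}\frac{(-1)^{k-1}}{k}u^k$ and $(1+u)^x=\sum_{k\ge 0}x(x-1)\cdots(x-k+1)\frac{u^k}{k!}$. The degenerate Cauchy numbers of the second kind $C_{n,\lambda}$ are defined by $$\frac{t}{\log\left(1+\frac{1}{\lambda}\log(1+\lambda t)\right)}=\sum_{n=0}^\infty C_{n,\lambda}\frac{t^n}{n!}.$$ The degenerate Cauchy polynomials $C_{n,\lambda}^*(x)$ are defined by $$\frac{\frac{1}{\lambda}\log(1+\lambda t)}{\log\left(1+\frac{1}{\lambda}\log(1+\lambda t)\right)}\left(1+\tfrac{1}{\lambda}\log(1+\lambda t)\right)^x=\sum_{n=0}^\infty C_{n,\lambda}^*(x)\frac{t^n}{n!},$$ and $C_{n,\lambda}^*=C_{n,\lambda}^*(0)$. For a positive integer $r$, the higher-order Daehee numbers $D_n^{(r)}$ are defined by $$\left(\frac{\log(1+t)}{t}\right)^r=\sum_{n=0}^\infty D_n^{(r)}\frac{t^n}{n!}.$$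 *)

(* Defs.v *)
From HB Require Import structures.
From mathcomp Require Import all_boot all_algebra boolp.
From mathcomp Require Import reals complex.

Set Implicit Arguments.
Unset Strict Implicit.
Unset Printing Implicit Defensive.

Import GRing.Theory.
Local Open Scope ring_scope.

(* Formal power series; the wrapper keeps the Cauchy product apart from the
   pointwise ring structure that function types may carry. *)
Record fps (K : Type) := Fps { fps_coef :> nat -> K }.

Section FpsRing.
Variable K : fieldType.
Implicit Types F G H : fps K.

Lemma fpsP F G : (forall n, F n = G n) <-> F = G.
Proof. by split=> [|-> //]; case: F G => f [g] /= /funext ->. Qed.

HB.instance Definition _ := gen_eqMixin (fps K).
HB.instance Definition _ := gen_choiceMixin (fps K).

Definition fps_add F G : fps K := Fps (fun n => F n + G n).
Definition fps_opp F : fps K := Fps (fun n => - F n).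
Definition fps_zero : fps K := Fps (fun=> 0).

Fact fps_addA : associative fps_add.
Proof. by move=> F G H; apply/fpsP => n /=; rewrite addrA. Qed.
Fact fps_addC : commutative fps_add.
Proof. by move=> F G; apply/fpsP => n /=; rewrite addrC. Qed.
Fact fps_add0 : left_id fps_zero fps_add.
Proof. by move=> F; apply/fpsP => n /=; rewrite add0r. Qed.
Fact fps_addN : left_inverse fps_zero fps_opp fps_add.
Proof. by move=> F; apply/fpsP => n /=; rewrite addNr. Qed.

HB.instance Definition _ :=
  GRing.isZmodule.Build (fps K) fps_addA fps_addC fps_add0 fps_addN.

Definition fps_mul F G : fps K :=
  Fps (fun n => \sum_(i < n.+1) F i * G (n - i)%N).
Definition fps_one : fps K := Fps (fun n => (n == 0%N)%:R).

Definition fps_trunc N F : {poly K} := \poly_(i < N) F i.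

Lemma coef_fps_trunc N F n : (n < N)%N -> (fps_trunc N F)`_n = F n.
Proof. by move=> nN; rewrite coef_poly nN. Qed.

Lemma fps_mul_trunc N F G n : (n < N)%N ->
  fps_mul F G n = (fps_trunc N F * fps_trunc N G)`_n.
Proof.
move=> nN; rewrite coefM; apply: eq_bigr => i _.
rewrite !coef_fps_trunc //; first by rewrite (leq_ltn_trans (leq_subr _ _)).
by rewrite (leq_ltn_trans _ nN) // -ltnS.
Qed.

Fact fps_mulC : commutative fps_mul.
Proof. by move=> F G; apply/fpsP => n; rewrite !(@fps_mul_trunc n.+1) // mulrC. Qed.

Fact fps_mulA : associative fps_mul.
Proof.
move=> F G H; apply/fpsP => n.
pose t := fps_trunc n.+1.
have lhs : fps_mul F (fps_mul G H) n = (t F * (t G * t H))`_n.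
  rewrite coefM; apply: eq_bigr => i _.
  have ni : (n - i < n.+1)%N by rewrite ltnS leq_subr.
  by rewrite (fps_mul_trunc _ _ ni) coef_fps_trunc.
have rhs : fps_mul (fps_mul F G) H n = (t F * t G * t H)`_n.
  rewrite coefM; apply: eq_bigr => i _.
  have ni : (n - i < n.+1)%N by rewrite ltnS leq_subr.
  by rewrite (fps_mul_trunc _ _ (ltn_ord i)) (coef_fps_trunc _ ni).
by rewrite lhs rhs mulrA.
Qed.

Fact fps_mul1 : left_id fps_one fps_mul.
Proof.
move=> F; apply/fpsP => n /=; rewrite big_ord_recl /= mul1r subn0.
by rewrite big1 ?addr0 // => i _; rewrite mul0r.
Qed.

Fact fps_mulDl : left_distributive fps_mul +%R.
Proof.
move=> F G H; apply/fpsP => n /=; rewrite -big_split /=.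
by apply: eq_bigr => i _; rewrite mulrDl.
Qed.

Fact fps_one_neq0 : fps_one != 0.
Proof.
apply/eqP => /fpsP /(_ 0%N) /= /eqP.
by rewrite oner_eq0.
Qed.

HB.instance Definition _ := GRing.Zmodule_isComNzRing.Build (fps K)
  fps_mulA fps_mulC fps_mul1 fps_mulDl fps_one_neq0.

Definition fps_scale (a : K) F : fps K := Fps (fun n => a * F n).

Fact fps_scaleA a b F : fps_scale a (fps_scale b F) = fps_scale (a * b) F.
Proof. by apply/fpsP => n /=; rewrite mulrA. Qed.
Fact fps_scale1 : left_id 1 fps_scale.
Proof. by move=> F; apply/fpsP => n /=; rewrite mul1r. Qed.
Fact fps_scaleDr : right_distributive fps_scale +%R.
Proof. by move=> a F G; apply/fpsP => n /=; rewrite mulrDr. Qed.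
Fact fps_scaleDl F : {morph fps_scale^~ F : a b / a + b}.
Proof. by move=> a b; apply/fpsP => n /=; rewrite mulrDl. Qed.

HB.instance Definition _ := GRing.Zmodule_isLmodule.Build K (fps K)
  fps_scaleA fps_scale1 fps_scaleDr fps_scaleDl.

Fact fps_scaleAl a F G : a *: (F * G) = a *: F * G.
Proof.
apply/fpsP => n /=; rewrite mulr_sumr.
by apply: eq_bigr => i _; rewrite mulrA.
Qed.

HB.instance Definition _ :=
  GRing.Lmodule_isLalgebra.Build K (fps K) fps_scaleAl.

Lemma fps_coefD F G n : (F + G) n = F n + G n. Proof. by []. Qed.
Lemma fps_coefN F n : (- F) n = - F n. Proof. by []. Qed.
Lemma fps_coef0 n : (0 : fps K) n = 0. Proof. by []. Qed.
Lemma fps_coef1 n : (1 : fps K) n = (n == 0%N)%:R. Proof. by []. Qed.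
Lemma fps_coefZ (a : K) F n : (a *: F) n = a * F n. Proof. by []. Qed.
Lemma fps_coefM F G n : (F * G) n = \sum_(i < n.+1) F i * G (n - i)%N.
Proof. by []. Qed.

Lemma fps_coefM0 F G : (F * G) 0%N = F 0%N * G 0%N.
Proof. by rewrite fps_coefM big_ord1. Qed.

Definition fpsX : fps K := Fps (fun n => (n == 1%N)%:R).

(* [fps_subst c U] is \sum_(k >= 0) c k *: U ^+ k for U without constant term:
   then U ^+ k has order at least k, so that only k <= n contribute to the
   coefficient of degree n. *)
Definition fps_subst (c : nat -> K) (U : fps K) : fps K :=
  Fps (fun n => \sum_(k < n.+1) c k * (U ^+ k) n).

Lemma fps_exp_order (U : fps K) k n :
  U 0%N = 0 -> (n < k)%N -> (U ^+ k) n = 0.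
Proof.
move=> U0; elim: k n => // k IHk n nk; rewrite exprS fps_coefM.
rewrite big_ord_recl /= U0 mul0r add0r big1 // => i _.
rewrite IHk ?mulr0 // /bump /= add1n.
case: n nk i => [|n] nk i; first by case: i.
by rewrite subSS; apply: leq_ltn_trans (leq_subr _ _) _.
Qed.

Definition fps_unit : {pred fps K} := [pred F : fps K | F 0%N != 0].

(* 1 / F = (F 0)^-1 \sum_k (1 - F / F 0) ^ k *)
Definition fps_inv F : fps K :=
  if F 0%N != 0
  then (F 0%N)^-1 *: fps_subst (fun=> 1) (1 - (F 0%N)^-1 *: F)
  else F.

Lemma fps_geom (U : fps K) : U 0%N = 0 -> fps_subst (fun=> 1) U * (1 - U) = 1.
Proof.
move=> U0; apply/fpsP => n.
pose S : fps K := \sum_(k < n.+1) U ^+ k.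
have coefS m : S m = \sum_(k < n.+1) (U ^+ k) m.
  rewrite /S; elim/big_rec2: _ => // k y F _ <-.
  by rewrite fps_coefD.
have -> : (fps_subst (fun=> 1) U * (1 - U)) n = (S * (1 - U)) n.
  rewrite !fps_coefM; apply: eq_bigr => i _; congr (_ * _).
  rewrite coefS /= (big_ord_widen n.+1 (fun k => 1 * (U ^+ k) i)) //.
  rewrite big_mkcond /=; apply: eq_bigr => k _; rewrite mul1r.
  by case: ltnP => // ik; rewrite fps_exp_order.
have -> : S * (1 - U) = 1 - U ^+ n.+1.
  by rewrite -[RHS]opprB subrX1 -mulNr opprB mulrC.
by rewrite fps_coefD fps_coefN fps_exp_order // subr0.
Qed.

Fact fps_mulVx : {in fps_unit, left_inverse 1 fps_inv *%R}.
Proof.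
move=> F; rewrite inE => F0; rewrite /fps_inv F0.
set U := 1 - _; have U0 : U 0%N = 0.
  by rewrite fps_coefD fps_coefN fps_coefZ mulVf // fps_coef1 subrr.
have -> : F = F 0%N *: (1 - U).
  by rewrite /U opprB addrC subrK scalerA mulfV // scale1r.
rewrite fps_coefZ fps_coefD fps_coefN U0 subr0 mulr1.
rewrite mulrC -!scalerAl mulrC -scalerAl fps_geom //.
by rewrite scalerA mulfV // scale1r.
Qed.

Fact fps_unitPl F G : G * F = 1 -> fps_unit F.
Proof.
move=> /fpsP /(_ 0%N); rewrite fps_coefM0 /fps_unit /= => GF.
by apply: contra_eq_neq GF => ->; rewrite mulr0 eq_sym oner_eq0.
Qed.

Fact fps_inv_out : {in [predC fps_unit], fps_inv =1 id}.
Proof. by move=> F; rewrite !inE /fps_inv => /negPf ->. Qed.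

HB.instance Definition _ := GRing.ComNzRing_hasMulInverse.Build (fps K)
  fps_mulVx fps_unitPl fps_inv_out.

(* The least degree of a nonzero coefficient (0 for the zero series). *)
Definition fps_order F : nat :=
  if pselect (exists n, F n != 0) is left e then ex_minn e else 0%N.

Definition fps_shift m F : fps K := Fps (fun n => F (m + n)%N).

(* The quotient F / G of formal power series for G != 0 dividing F: a common
   factor fpsX ^+ fps_order G is removed, after which G becomes invertible.
   The ring inverse alone does not suffice, as G may have order > 0. *)
Definition fps_div F G : fps K :=
  fps_shift (fps_order G) F / fps_shift (fps_order G) G.

Lemma fpsXnM m F n : (fpsX ^+ m * F) n = if (n < m)%N then 0 else F (n - m)%N.
Proof.
elim: m n => [|m IHm] n; first by rewrite mul1r subn0.
rewrite exprS -mulrA fps_coefM; move: (fpsX ^+ m * F) IHm => G IHm.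
rewrite big_ord_recl /= mul0r add0r.
case: n => [|n]; first by rewrite big_ord0.
rewrite big_ord_recl /= mul1r IHm big1 => [|i _]; last by rewrite mul0r.
by rewrite addr0 /bump /= add1n subSS subn0 ltnS.
Qed.

Lemma fps_order_shift F : F != 0 ->
  fps_shift (fps_order F) F 0%N != 0 /\
  F = fpsX ^+ fps_order F * fps_shift (fps_order F) F.
Proof.
move=> F0; rewrite /fps_order; case: pselect => [e|ne]; last first.
  case/eqP: F0; apply/fpsP => n; rewrite fps_coef0.
  by apply/eqP/negPn/negP => Fn; apply: ne; exists n.
case: ex_minnP => m Fm minm; split; first by rewrite /= addn0.
apply/fpsP => n; rewrite fpsXnM /=; case: ltnP => [nm|mn]; last by rewrite subnKC.
by apply/eqP/negPn/negP => /minm; rewrite leqNgt nm.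
Qed.

Lemma fps_mulK_div F G : G != 0 -> fps_div (F * G) G = F.
Proof.
move=> G0; have [u eG] := fps_order_shift G0.
rewrite /fps_div; set m := fps_order G in u eG *; set H := fps_shift m G in u eG *.
have -> : fps_shift m (F * G) = F * H.
  apply/fpsP => n; transitivity ((fpsX ^+ m * (F * H)) (m + n)%N).
    by rewrite mulrCA -eG.
  by rewrite fpsXnM ltnNge leq_addr /= addKn.
by rewrite mulrK.
Qed.

(* log (1 + U) *)
Definition fps_log1p (U : fps K) : fps K :=
  fps_subst (fun k => if k == 0%N then 0 else (-1) ^+ k.-1 / k%:R) U.

(* (1 + U) ^ x *)
Definition fps_pow1p (U : fps K) (x : K) : fps K :=
  fps_subst (fun k => (\prod_(i < k) (x - i%:R)) / k`!%:R) U.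

(* The a_n such that F = \sum_n a_n t^n / n! *)
Definition egf_coef F (n : nat) : K := n`!%:R * F n.

(* (1 / lambda) log (1 + lambda t) *)
Definition deg_log (lambda : K) : fps K :=
  lambda^-1 *: fps_log1p (lambda *: fpsX).

Definition deg_cauchy2 (lambda : K) : nat -> K :=
  egf_coef (fps_div fpsX (fps_log1p (deg_log lambda))).

Definition deg_cauchy_poly (lambda : K) (n : nat) (x : K) : K :=
  egf_coef (fps_div (deg_log lambda) (fps_log1p (deg_log lambda))
            * fps_pow1p (deg_log lambda) x) n.

Definition daehee (r : nat) : nat -> K :=
  egf_coef (fps_div (fps_log1p fpsX) fpsX ^+ r).

End FpsRing.

Arguments daehee {K} r n.

(* Main.v *)
Require Import Defs.
From mathcomp Require Import all_boot all_algebra.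
From mathcomp Require Import reals complex.

Set Implicit Arguments.
Unset Strict Implicit.
Unset Printing Implicit Defensive.

Import GRing.Theory.
Local Open Scope ring_scope.

(** Put u = (1/lambda) log(1 + lambda t) and L = log(1 + u). Since
    (1 + u)^1 - (1 + u)^0 = u, the left-hand side is n! times the coefficient of
    t^(n+1) in u^2 / L. As log(1 + s) / s at s = lambda t is u / t, the right-hand
    side is n! times the coefficient of t^n in (t / L) (u / t)^2. *)

Section FpsTheory.
Variable K : fieldType.
Implicit Types (F G U : fps K) (a : K).

Lemma fps_coefX_exp k n : (fpsX K ^+ k) n = (n == k)%:R.
Proof.
rewrite -[_ ^+ _]mulr1 fpsXnM fps_coef1 subn_eq0 eqn_leq.
by case: (ltnP n k) => [|nk]; rewrite ?andbF ?andbT.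
Qed.

Lemma fps_coefXM F n : (fpsX K * F) n.+1 = F n.
Proof. by rewrite -[fpsX K]expr1 fpsXnM subn1. Qed.

Lemma fps_mulX_shift F : F 0%N = 0 -> F = fpsX K * fps_shift 1 F.
Proof.
move=> F0; apply/fpsP => -[|n]; last by rewrite fps_coefXM.
by rewrite fps_coefM0 mul0r.
Qed.

Lemma fps_shiftX : fps_shift 1 (fpsX K) = 1.
Proof. exact/fpsP. Qed.

(** The scalar is written [a ^+ n] rather than [a ^+ k]: both sides vanish unless n = k, and a
    factor depending on the degree alone expresses the dilation t -> a t. *)
Lemma fps_coefZX_exp a k n : ((a *: fpsX K) ^+ k) n = a ^+ n * (n == k)%:R.
Proof.
have -> : (a *: fpsX K) ^+ k = a ^+ k *: fpsX K ^+ k.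
  elim: k => [|k IHk]; first by rewrite !expr0 scale1r.
  by rewrite !exprS IHk -scalerAl mulrC -scalerAl scalerA [_ * fpsX K]mulrC.
rewrite fps_coefZ fps_coefX_exp.
by case: eqP => [->|_]; rewrite ?mulr0.
Qed.

Lemma fps_substZX (c : nat -> K) a n : fps_subst c (a *: fpsX K) n = a ^+ n * c n.
Proof.
rewrite /= big_ord_recr /= fps_coefZX_exp eqxx mulr1 big1 ?add0r 1?mulrC //.
by move=> i _; rewrite fps_coefZX_exp gtn_eqF ?mulr0.
Qed.

Lemma fps_subst_coef0 (c : nat -> K) U : fps_subst c U 0%N = c 0%N.
Proof. by rewrite /= big_ord1 expr0 fps_coef1 mulr1. Qed.

Lemma fps_subst_coef1 (c : nat -> K) U : fps_subst c U 1%N = c 1%N * U 1%N.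
Proof.
by rewrite /= big_ord_recl big_ord1 expr0 fps_coef1 mulr0 add0r expr1.
Qed.

Lemma fps_log1p_coef0 U : fps_log1p U 0%N = 0.
Proof. exact: fps_subst_coef0. Qed.

Lemma fps_log1p_coef1 U : fps_log1p U 1%N = U 1%N.
Proof. by rewrite /fps_log1p fps_subst_coef1 expr0 divr1 mul1r. Qed.

Lemma fps_log1pZX a n : fps_log1p (a *: fpsX K) n = a ^+ n * fps_log1p (fpsX K) n.
Proof.
by rewrite -{2}[fpsX K]scale1r /fps_log1p !fps_substZX expr1n mul1r.
Qed.

Lemma fps_pow1p0 U : fps_pow1p U 0 = 1.
Proof.
apply/fpsP => n; rewrite /= big_ord_recl big_ord0 divr1 mul1r expr0 big1 ?addr0 //.
by move=> i _; rewrite big_ord_recl subrr !mul0r.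
Qed.

(** For k >= 2 the product 1 (1 - 1) ... vanishes at its second factor, so only k = 0 and k = 1
    contribute. In degree 0 the truncated sum of [fps_subst] stops at k = 0, hence the condition on
    [U 0]. *)
Lemma fps_pow1p1 U : U 0%N = 0 -> fps_pow1p U 1 = 1 + U.
Proof.
move=> U0; apply/fpsP => -[|n].
  by rewrite fps_subst_coef0 big_ord0 divr1 fps_coefD U0 addr0.
rewrite /= 2!big_ord_recl big_ord0 big_ord_recl big_ord0 big1 ?addr0 => [|i _].
  by rewrite subr0 mulr1 !divr1 !mul1r expr0 expr1.
by rewrite 2!big_ord_recl /bump /= subrr mul0r mulr0 !mul0r.
Qed.

(** The dilation t -> a t is multiplicative, as [a ^+ i * a ^+ (n - i)] is [a ^+ n]; the square is
    what carries (u / t)^2 to the Daehee numbers of order 2. *)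
Lemma fps_coefM_dilate a F G :
  (forall n, F n = a ^+ n * G n) -> forall n, (F * F) n = a ^+ n * (G * G) n.
Proof.
move=> FG n; rewrite !fps_coefM mulr_sumr; apply: eq_bigr => i _.
by rewrite !FG mulrACA -exprD subnKC // -ltnS.
Qed.

Lemma egf_coefM F G n :
  egf_coef (F * G) n =
  \sum_(l < n.+1) 'C(n, l)%:R * egf_coef F l * egf_coef G (n - l).
Proof.
rewrite /egf_coef fps_coefM mulr_sumr; apply: eq_bigr => l _.
have -> : n`!%:R = 'C(n, l)%:R * (l`!%:R * (n - l)`!%:R) :> K.
  by rewrite -!natrM bin_fact // -ltnS.
by rewrite -!mulrA [(n - l)`!%:R * _]mulrCA.
Qed.

Lemma deg_log_coef0 a : deg_log a 0%N = 0.
Proof. by rewrite fps_coefZ fps_log1p_coef0 mulr0. Qed.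

Lemma deg_log_coef1 a : a != 0 -> deg_log a 1%N = 1.
Proof.
by move=> a0; rewrite fps_coefZ fps_log1p_coef1 fps_coefZ mulr1 mulVf.
Qed.

(** The shift reads the coefficient of degree n + 1, which carries [a ^+ n.+1]; the prefactor 1 / a
    of [deg_log] cancels one power. *)
Lemma shift_deg_log a n : a != 0 ->
  fps_shift 1 (deg_log a) n = a ^+ n * fps_shift 1 (fps_log1p (fpsX K)) n.
Proof.
move=> a0; rewrite [LHS]fps_coefZ fps_log1pZX add1n exprS.
by rewrite !mulrA mulVf // mul1r.
Qed.

Lemma fps_divX F : F 0%N = 0 -> fps_div F (fpsX K) = fps_shift 1 F.
Proof.
move=> F0; rewrite {1}(fps_mulX_shift F0) mulrC fps_mulK_div //.
by apply/eqP => /fpsP /(_ 1%N) /eqP; rewrite oner_eq0.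
Qed.

(** A factor t cancels, and G / t is invertible since its constant term is [G 1]. Exhibiting F as a
    multiple of G avoids computing [fps_order G]. *)
Lemma fps_div_shift F G : F 0%N = 0 -> G 0%N = 0 -> G 1%N != 0 ->
  fps_div F G = fps_shift 1 F / fps_shift 1 G.
Proof.
move=> F0 G0 G1; have uG : fps_shift 1 G \is a GRing.unit by [].
have FG : F = fps_shift 1 F / fps_shift 1 G * G.
  by rewrite {2}(fps_mulX_shift G0) mulrCA divrK // -fps_mulX_shift.
by rewrite {1}FG fps_mulK_div //; apply: contraNneq G1 => ->.
Qed.

End FpsTheory.

Theorem theorem2p8 (R : realType) (lambda : R[i]) (lambda_neq0 : lambda != 0)
    (n : nat) :
  (deg_cauchy_poly lambda n.+1 1 - deg_cauchy_poly lambda n.+1 0) / n.+1%:R =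
  \sum_(l < n.+1)
     'C(n, l)%:R * deg_cauchy2 lambda l * lambda ^+ (n - l) * daehee 2 (n - l).
Proof.
rewrite /deg_cauchy_poly /deg_cauchy2 /daehee.
set u := deg_log lambda; set L := fps_log1p u.
have u0 : u 0%N = 0 := deg_log_coef0 _.
have L0 : L 0%N = 0 := fps_log1p_coef0 _.
have L1 : L 1%N != 0 by rewrite fps_log1p_coef1 deg_log_coef1 ?oner_eq0.
(* M = L / t and W = u / t, so t / L = 1 / M and u / L = W / M. *)
set M := fps_shift 1 L; set W := fps_shift 1 u.
have -> : fps_div (fpsX _) L = M^-1.
  by rewrite fps_div_shift // fps_shiftX mul1r.
have -> : fps_div u L = W / M by exact: fps_div_shift.
rewrite fps_divX ?fps_log1p_coef0 //; set E := fps_shift 1 _.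
have WW : forall m, (W * W) m = lambda ^+ m * (E * E) m.
  by apply: fps_coefM_dilate => m; apply: shift_deg_log.
rewrite fps_pow1p0 fps_pow1p1 // mulrDr mulr1.
transitivity (egf_coef (M^-1 * (W * W)) n).
  (* The difference leaves (W / M) u with u = t W: the factor t lowers the degree from n + 1 to n,
     and (n + 1)! / (n + 1) = n!. *)
  rewrite /egf_coef -mulrBr fps_coefD addrC addKr {1}(fps_mulX_shift u0).
  rewrite mulrCA fps_coefXM factS natrM -mulrA mulrC mulrA mulrVK.
    by rewrite mulrAC mulrC [W * W * _]mulrC.
  by rewrite unitfE Num.Theory.pnatr_eq0.
rewrite egf_coefM; apply: eq_bigr => l _.
by rewrite -[RHS]mulrA; congr (_ * _); rewrite /egf_coef WW mulrCA expr2.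
Qed.
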